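(* Fix an iteration $i$, a stage $t\in\{2,\ldots,T\}$, a sampled path $k$, and a binary incumbent state $x_{t-1}^{ik}\in\{0,1\}^{h_{t-1}}$. For each $j\in\{1,\ldots,N_t\}$ let $L(\psi_t^{i+1},\omega_t^j)\in\mathbb{R}$ satisfy $\underline{Q}_t^i(x,\psi_t^{i+1},\omega_t^j)\ge L(\psi_t^{i+1},\omega_t^j)$ for all $x\in\{0,1\}^{h_{t-1}}$. Then the integer L-shaped cut $$\theta_{t-1}\ge\sum_{j=1}^{N_t}q_t^j\Biggl(\left(\underline{Q}_t^i(x_{t-1}^{ik},\psi_t^{i+1},\omega_t^j)-L(\psi_t^{i+1},\omega_t^j)\right)\Bigl(\sum_{r:x_{t-1,r}^{ik}=1}(x_{t-1,r}-1)-\sum_{r:x_{t-1,r}^{ik}=0}x_{t-1,r}\Bigr)+\underline{Q}_t^i(x_{t-1}^{ik},\psi_t^{i+1},\omega_t^j)\Biggr)$$ is one of the Lagrangian cuts: there exist, for each $j=1,\ldots,N_t$, an optimal solution $\pi_t^{ij}\in\mathbb{R}^{h_{t-1}}$ of the Lagrangian dual problem $\max_{\pi\in\mathbb{R}^{h_{t-1}}}\left(\mathcal{L}_t^i(\pi;\omega_t^j)+\pi^\top x_{t-1}^{ik}\right)$ such that the right-hand side of the integer L-shaped cut equals, as an affine function of $x_{t-1}$, the right-hand side of the Lagrangian cut $$\theta_{t-1}\ge\sum_{j=1}^{N_t}q_t^j\left(\mathcal{L}_t^i(\pi_t^{ij};\omega_t^j)+(\pi_t^{ij})^\top x_{t-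1}\right).$$
   Context: Setting: a $T$-stage stochastic mixed-integer program with stage-wise independent uncertainty. At stage $t$ there are $N_t$ realizations $\omega_t^1,\ldots,\omega_t^{N_t}$, with probabilities $q_t^1,\ldots,q_t^{N_t}$. The state vector at stage $t$ is $x_t$, of dimension $h_t$, and is binary; $y_t$ is the vector of local variables. The data $\omega_t^j$ determine a real-valued objective function $f_t(x_t,y_t,\omega_t^j)$ and a constraint set $X_t$ (which may depend on $\omega_t^j$) of triples $(z_t,x_t,y_t)$, where $z_t$ is a copy of the previous stage's state; $X_t$ includes any integrality restrictions on $x_t,y_t$. The function $\psi_t^{i+1}:\mathbb{R}^{h_t}\to\mathbb{R}$ is the current approximation of the expected cost-to-go, a pointwise maximum of finitely many affine functions. The variable $\theta_{t-1}$ represents the approximate expected future cost at stage $t-1$, and a cut is an inequality bounding $\theta_{t-1}$ below by an affine function of $x_{t-1}$. $x_{t-1,r}$ denotes the $r$-th component of $x_{t-1}$. For $x\in\{0,1\}^{h_{t-1}}$ the approximate value function is $$\underline{Q}_t^i(x,\psi_t^{i+1},\omega_t^j)=\min_{x_t,y_t,z_t}\left\{f_t(x_t,y_t,\omega_t^j)+\psi_t^{i+1}(x_t) : z_t=x,\ z_t\in\{0,1\}^{h_{t-1}},\ (z_t,x_t,y_t)\in X_t\right\}.$$ For $\pi\in\mathbb{R}^{h_{t-1}}$ the Lagrangian function, obtained by relaxing $z_t=x$, is $$\mathcal{L}_t^i(\pi;\omega_t^j)=\min_{x_t,y_t,z_t}\left\{f_t(x_t,y_t,\omega_t^j)+\psi_t^{i+1}(x_t)-\pi^\top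 z_t : z_t\in\{0,1\}^{h_{t-1}},\ (z_t,x_t,y_t)\in X_t\right\}.$$ A Lagrangian cut at the incumbent $x_{t-1}^{ik}$ is an inequality $\theta_{t-1}\ge\sum_{j}q_t^j(\mathcal{L}_t^i(\pi_t^{ij};\omega_t^j)+(\pi_t^{ij})^\top x_{t-1})$ in which each $\pi_t^{ij}$ is optimal for the Lagrangian dual problem $\max_\pi(\mathcal{L}_t^i(\pi;\omega_t^j)+\pi^\top x_{t-1}^{ik})$. Standing assumptions: relatively complete recourse (for every $x\in\{0,1\}^{h_{t-1}}$ the problem defining $\underline{Q}_t^i(x,\psi_t^{i+1},\omega_t^j)$ is feasible), and the minimum defining $\underline{Q}_t^i(x,\psi_t^{i+1},\omega_t^j)$ is finite and attained for every such $x$ and every $j$. *)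

(* Defs.v *)
From mathcomp Require Import all_boot all_order all_algebra.
From mathcomp Require Import boolp classical_sets reals.
Set Implicit Arguments.
Unset Strict Implicit.
Unset Printing Implicit Defensive.
Import Order.TTheory GRing.Theory Num.Theory.
Local Open Scope classical_set_scope.
Local Open Scope ring_scope.

Definition dotv (R : realType) (n : nat) (u v : 'cV[R]_n) : R :=
  (u^T *m v) 0 0.

Definition binary (R : realType) (n : nat) : set 'cV[R]_n :=
  [set x | forall r, x r 0 = 0 \/ x r 0 = 1].

Definition max_affine (R : realType) (n : nat) (psi : 'cV[R]_n -> R) : Prop :=
  exists (K : nat) (a : 'I_K.+1 -> 'cV[R]_n) (b : 'I_K.+1 -> R),
    forall x, psi x =
      \big[Num.max/(dotv (a ord0) x + b ord0)]_(l < K.+1) (dotv (a l) x + b l).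

(* Stage-wise independence is built in: the realizations of a stage and their
   probabilities do not depend on the history. Stages are numbered 1, ..., T;
   the fields are indexed by all of nat and only these indices are meaningful.
   The state dimension of "stage 0" is that of the initial state. *)
Record msip (R : realType) := Msip {
  nstages : nat;
  nreal : nat -> nat;
  sdim : nat -> nat;
  ldim : nat -> nat;
  data : nat -> Type;
  omega : forall t, 'I_(nreal t) -> data t;
  prob : forall t, 'I_(nreal t) -> R;
  obj : forall t, 'cV[R]_(sdim t) -> 'cV[R]_(ldim t) -> data t -> R;
  constr : forall t, data t ->
    set ('cV[R]_(sdim t.-1) * 'cV[R]_(sdim t) * 'cV[R]_(ldim t));
  prob_ge0 : forall t j, (1 <= t <= nstages)%N -> 0 <= prob (t := t) j;
  prob_sum1 : forall t, (1 <= t <= nstages)%N -> \sum_j prob (t := t) j = 1;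
  constr_binary : forall t w z x y, (1 <= t <= nstages)%N ->
    constr (t := t) w (z, x, y) -> binary x }.

Section MinValue.
Variables (R : realType) (T : Type).

Definition minimizer (A : set T) (g : T -> R) (p : T) : Prop :=
  A p /\ forall p', A p' -> g p <= g p'.

(* The infimum in R; it is meaningful only when a minimizer exists. This is a
   hypothesis for the value functions and is proved for the Lagrangian
   functions in lagrangian_attained. *)
Definition minval (A : set T) (g : T -> R) : R := inf (g @` A).

Lemma minvalE (A : set T) (g : T -> R) p : minimizer A g p -> minval A g = g p.
Proof.
move=> [Ap gp]; have lb : lbound (g @` A) (g p).
  by move=> _ [p' Ap' <-]; exact: gp.
apply/le_anti/andP; split.
  by apply: ge_inf; [exists (g p) | exists p].
by apply: lb_le_inf => //; exists (g p); exists p.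
Qed.

End MinValue.

Section StageProblem.
Variables (R : realType) (P : msip R) (t : nat).
Local Notation hprev := (sdim P t.-1).
Local Notation point :=
  ('cV[R]_(sdim P t.-1) * 'cV[R]_(sdim P t) * 'cV[R]_(ldim P t))%type.
Implicit Types (psi : 'cV[R]_(sdim P t) -> R) (w : data P t).

Definition stage_cost psi w (p : point) : R :=
  let: (_, xt, yt) := p in obj xt yt w + psi xt.

Definition relaxed_feasible w : set point :=
  [set p | binary p.1.1 /\ constr w p].

Definition feasible w (x : 'cV[R]_hprev) : set point :=
  [set p | p.1.1 = x /\ relaxed_feasible w p].

Definition value_fun (x : 'cV[R]_hprev) psi w : R :=
  minval (feasible w x) (stage_cost psi w).

Definition lagrangian_cost psi w (pi : 'cV[R]_hprev) (p : point) : R :=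
  stage_cost psi w p - dotv pi p.1.1.

Definition lagrangian psi w (pi : 'cV[R]_hprev) : R :=
  minval (relaxed_feasible w) (lagrangian_cost psi w pi).

Definition lagrangian_dual_optimal psi w (xinc pi : 'cV[R]_hprev) : Prop :=
  forall pi', lagrangian psi w pi' + dotv pi' xinc
           <= lagrangian psi w pi + dotv pi xinc.

Definition lagrangian_cut_rhs psi (pi : 'I_(nreal P t) -> 'cV[R]_hprev)
    (x : 'cV[R]_hprev) : R :=
  \sum_j prob j * (lagrangian psi (omega j) (pi j) + dotv (pi j) x).

Definition integer_lshaped_rhs psi (xinc : 'cV[R]_hprev)
    (L : 'I_(nreal P t) -> R) (x : 'cV[R]_hprev) : R :=
  \sum_j prob j *
    ((value_fun xinc psi (omega j) - L j) *
       (\sum_(r | xinc r 0 == 1) (x r 0 - 1) - \sum_(r | xinc r 0 == 0) x r 0)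
     + value_fun xinc psi (omega j)).

Definition relatively_complete_recourse : Prop :=
  forall (j : 'I_(nreal P t)) (x : 'cV[R]_hprev), binary x ->
    feasible (omega j) x !=set0.

Definition value_attained psi : Prop :=
  forall (j : 'I_(nreal P t)) (x : 'cV[R]_hprev), binary x ->
    exists p, minimizer (feasible (omega j) x) (stage_cost psi (omega j)) p.

Lemma lagrangian_attained psi : value_attained psi ->
  forall j pi, exists p, minimizer (relaxed_feasible (omega j))
                           (lagrangian_cost psi (omega j) pi) p.
Proof.
move=> att j pi.
pose zb (b : {ffun 'I_hprev -> bool}) : 'cV[R]_hprev := \col_r (b r)%:R.
have zbB b : binary (zb b).
  by move=> r; rewrite mxE; case: (b r); [right | left].
have [s sP] := choice (fun b => att j (zb b) (zbB b)).
pose g b := lagrangian_cost psi (omega j) pi (s b).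
case: (@arg_minP _ R _ [ffun=> false] predT g isT) => b _ bmin.
exists (s b); split; first by have [[_ ?] _] := sP b.
move=> p [pB pX]; pose c := [ffun r => p.1.1 r 0 == 1].
have pc : p.1.1 = zb c.
  apply/colP => r; rewrite mxE ffunE.
  by case: (pB r) => ->; rewrite ?eqxx // eq_sym oner_eq0.
apply: (le_trans (bmin c isT)); rewrite /g /lagrangian_cost.
by have [[-> _] cmin] := sP c; rewrite -pc lerD2r; apply: cmin.
Qed.

End StageProblem.

(* Main.v *)
Require Import Defs.
From mathcomp Require Import all_boot all_order all_algebra.
From mathcomp Require Import boolp classical_sets reals.
Import Order.TTheory GRing.Theory Num.Theory.
Local Open Scope ring_scope.

(** Write [u] for the binary incumbent and, for one realization, [Q] for the
    value function at [u] and [L] for the given lower bound.  For binary [z] the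
    bracket of the integer L-shaped cut is minus the Hamming distance from [u]
    to [z].  As a function of an arbitrary vector [x] it is affine, vanishes at
    [u], and has slope [+1] where [u] is 1 and [-1] where [u] is 0
    ([dotv_lshaped_slope]).  Matching the slopes of the two cuts realization by
    realization dictates the multiplier: [pi] is [Q - L] times this slope vector.

    With this [pi], moving the copy [z] away from [u] in the Lagrangian problem
    costs a penalty of at least [Q - L] ([lshaped_bracket_le]), while the stage
    cost at [z] is at least [L]; so no relaxed point does better than [Q], and the
    Lagrangian bound at [u] is exactly [Q] ([lagrangian_tight]).  By weak duality
    ([lagrangian_weak_duality]) no multiplier gives more: [pi] is optimal.
    Tightness at [u] also matches the constant terms of the two cuts, and the
    slopes match by the choice of [pi]. *)

Section IncumbentDistance.
Set Implicit Arguments.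
Unset Strict Implicit.
Variables (R : realType) (n : nat).
Implicit Types (u x z : 'cV[R]_n) (c : R).

Definition lshaped_slope c u : 'cV[R]_n :=
  \col_r (if u r 0 == 1 then c else - c).

Definition lshaped_bracket u x : R :=
  \sum_(r | u r 0 == 1) (x r 0 - 1) - \sum_(r | u r 0 == 0) x r 0.

Lemma dotvE u x : dotv u x = \sum_r u r 0 * x r 0.
Proof. by rewrite /dotv mxE; apply: eq_bigr => r _; rewrite mxE. Qed.

Lemma lshaped_bracketE u x : binary u ->
  lshaped_bracket u x = \sum_r (if u r 0 == 1 then x r 0 - 1 else - x r 0).
Proof.
move=> ub; rewrite /lshaped_bracket -sumrN [RHS](bigID (fun r => u r 0 == 1)) /=.
congr (_ + _); first by apply: eq_bigr => r ->.
apply: eq_big => [r|r /eqP ->]; last by rewrite eq_sym oner_eq0.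
by case: (ub r) => ->; rewrite ?eqxx ?oner_eq0 // eq_sym oner_eq0.
Qed.

Lemma dotv_lshaped_slope c u x : binary u ->
  dotv (lshaped_slope c u) x - dotv (lshaped_slope c u) u
  = c * lshaped_bracket u x.
Proof.
move=> ub; rewrite lshaped_bracketE // !dotvE -sumrB mulr_sumr.
apply: eq_bigr => r _; rewrite mxE -mulrBr.
case: (ub r) => ->; last by rewrite eqxx.
by rewrite eq_sym oner_eq0 subr0 mulrN mulNr.
Qed.

(** The Hamming distance between distinct binary vectors is at least 1. *)
Lemma lshaped_bracket_le u z : binary u -> binary z -> z != u ->
  lshaped_bracket u z <= -1.
Proof.
move=> ub zb zu; rewrite lshaped_bracketE //.
have [r0 zr0] : exists r, z r 0 != u r 0.
  apply/existsP; apply: contraR zu; rewrite negb_exists => /forallP zu.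
  by apply/eqP/colP => r; apply/eqP; have := zu r; rewrite negbK.
rewrite (bigD1 r0) //= -[leRHS]addr0 lerD //.
  move: zr0; case: (ub r0) => ->; case: (zb r0) => ->;
    by rewrite ?eqxx ?[0 == 1]eq_sym ?oner_eq0 ?sub0r.
apply: sumr_le0 => r _.
case: (ub r) => ->; case: (zb r) => ->;
  by rewrite ?eqxx ?subrr ?sub0r ?oppr0 ?[0 == 1]eq_sym ?oner_eq0 ?oppr_le0 ?ler01.
Qed.

End IncumbentDistance.

Section LagrangianBound.
Set Implicit Arguments.
Unset Strict Implicit.
Variables (R : realType) (P : msip R) (t : nat).
Variable psi : 'cV[R]_(sdim P t) -> R.
Hypothesis att : value_attained psi.
Implicit Types (j : 'I_(nreal P t)) (x u pi : 'cV[R]_(sdim P t.-1)).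

Lemma value_fun_le j p : relaxed_feasible (omega j) p ->
  value_fun p.1.1 psi (omega j) <= stage_cost psi (omega j) p.
Proof.
move=> fp; have [q qmin] := att j fp.1.
by rewrite /value_fun (minvalE qmin); apply: qmin.2.
Qed.

(** Any point feasible for [z = x] is also feasible for the relaxation, where the
    Lagrangian term contributes exactly [- dotv pi x]. *)
Lemma lagrangian_weak_duality j pi x : binary x ->
  lagrangian psi (omega j) pi + dotv pi x <= value_fun x psi (omega j).
Proof.
move=> xb; have [q qmin] := att j xb.
have [p pmin] := lagrangian_attained att j pi.
rewrite /value_fun (minvalE qmin) /lagrangian (minvalE pmin).
have [[qx fq] _] := qmin.
by rewrite -lerBrDr -qx; apply: pmin.2.
Qed.

(** A bound [l] on the value function caps what the relaxation can gain by
    moving away from [u], and the slope charges at least that gain. *)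
Lemma lagrangian_tight j u (l : R) : binary u ->
  (forall x, binary x -> l <= value_fun x psi (omega j)) ->
  let pi := lshaped_slope (value_fun u psi (omega j) - l) u in
  lagrangian psi (omega j) pi + dotv pi u = value_fun u psi (omega j).
Proof.
move=> ub lb pi; apply/le_anti/andP; split; first exact: lagrangian_weak_duality.
have [p pmin] := lagrangian_attained att j pi.
rewrite /lagrangian (minvalE pmin) /lagrangian_cost.
have fp := pmin.1; have Qp := value_fun_le fp.
(* The multiplier terms combine into [dotv pi u - dotv pi z], which is minus the
   bracket scaled by [Q - l]. *)
rewrite -addrA [- _ + _]addrC -opprB dotv_lshaped_slope //.
have [pu|pu] := eqVneq p.1.1 u.
  by rewrite -dotv_lshaped_slope // pu subrr subr0 -pu.
have gap : 0 <= value_fun u psi (omega j) - l by rewrite subr_ge0 lb.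
have := lshaped_bracket_le ub fp.1 pu.
move=> /(ler_wpM2l gap); rewrite mulrN1 => pen.
rewrite lerBrDr (le_trans (lerD (lexx _) pen)) // opprB addrC subrK.
exact: le_trans (lb _ fp.1) Qp.
Qed.

End LagrangianBound.

Theorem corollary1 (R : realType) (P : msip R)
  (psi : nat -> forall s : nat, 'cV[R]_(sdim P s) -> R)
  (xinc : nat -> nat -> forall s : nat, 'cV[R]_(sdim P s))
  (i t k : nat) (L : 'I_(nreal P t) -> R)
  (ht : (2 <= t <= nstages P)%N)
  (hpsi : max_affine (psi i.+1 t))
  (hxinc : binary (xinc i k t.-1))
  (hrecourse : relatively_complete_recourse P t)
  (hatt : value_attained (psi i.+1 t))
  (hL : forall (j : 'I_(nreal P t)) (x : 'cV[R]_(sdim P t.-1)), binary x ->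
      L j <= value_fun x (psi i.+1 t) (omega j)) :
  exists pi : 'I_(nreal P t) -> 'cV[R]_(sdim P t.-1),
    (forall j : 'I_(nreal P t),
       lagrangian_dual_optimal (psi i.+1 t) (omega j) (xinc i k t.-1) (pi j)) /\
    (forall x : 'cV[R]_(sdim P t.-1),
       integer_lshaped_rhs (psi i.+1 t) (xinc i k t.-1) L x
       = lagrangian_cut_rhs (psi i.+1 t) pi x).
Proof.
pose u := xinc i k t.-1.
pose Q j := value_fun u (psi i.+1 t) (omega j).
exists (fun j => lshaped_slope (Q j - L j) u).
have tight j := lagrangian_tight hatt hxinc (hL j).
split=> [j pi'|x]; first by rewrite tight; apply: lagrangian_weak_duality.
rewrite /integer_lshaped_rhs /lagrangian_cut_rhs; apply: eq_bigr => j _.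
rewrite -/(lshaped_bracket u x) -dotv_lshaped_slope //.
by congr (_ * _); rewrite -[X in _ + X = _]tight addrC addrACA subrr addr0.
Qed.
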